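(* Let $d\ge 2$ and let $S\subset\mathbb{R}^d$ be a finite set of distinct points with $|S|$ odd. For a point $x\in S$, the following three conditions are equivalent: (i) every affine hyperplane through $x$ is good; (ii) every perfect hyperplane contains $x$; (iii) every line through $x$ is even-balanced about $x$. Alice wins if and only if there exists a point $x\in S$ satisfying these conditions, and in that case $a=x$ is a winning point for Alice.
   Context: The game: Alice chooses $a\in\mathbb{R}^d$; then Bob, knowing $a$, chooses $b\in\mathbb{R}^d$. With $\rho$ the Euclidean distance, $V_A=|\{y\in S:\rho(a,y)<\rho(b,y)\}|$ and $V_B=|\{y\in S:\rho(b,y)<\rho(a,y)\}|$. A point $a$ is a winning point for Alice if $V_A\ge V_B$ for every $b\in\mathbb{R}^d$; Alice wins if a winning point exists. For an affine hyperplane $H=\{y:\langle y,c\rangle=\lambda\}$ ($c\ne0$) write $H^+=\{y:\langle y,c\rangle>\lambda\}$, $H^-=\{y:\langle y,c\rangle<\lambda\}$. When $|S|$ is odd, $H$ is good if $|H^+\cap S|=|H^-\cap S|$, and perfect if it is good and $|H\cap S|=1$. For a line $l$ through $x$, let $l^+,l^-$ be the two open half-lines into which $x$ divides $l$; $l$ is balanced about $x$ if $\big||l^+\cap S|-|l^-\cap S|\big|\le1$, and even-balanced about $x$ if it is balanced and $|(l\setminus\{x\})\cap S|$ is even (equivalently $|l^+\cap S|=|l^-\cap S|$). *)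

(* Defs.v *)
From mathcomp Require Import all_boot all_order all_algebra finmap.
From mathcomp Require Import boolp classical_sets reals.

Set Implicit Arguments.
Unset Strict Implicit.
Unset Printing Implicit Defensive.

Import Order.TTheory GRing.Theory Num.Theory.

Local Open Scope classical_set_scope.
Local Open Scope ring_scope.

Definition dot (R : realType) (d : nat) (u v : 'rV[R]_d) : R :=
  \sum_(i < d) u 0 i * v 0 i.

(* MathComp-Analysis equips 'rV[R]_d with the sup norm, so the Euclidean
   distance is defined explicitly. *)
Definition edist (R : realType) (d : nat) (u v : 'rV[R]_d) : R :=
  Num.sqrt (dot (u - v) (u - v)).

Definition npts (R : realType) (d : nat) (S : {fset 'rV[R]_d})
    (A : set 'rV[R]_d) : nat :=
  #|` [fset y in S | y \in A]%fset|.

(* V_A is [votes S a b] and V_B is [votes S b a]. *)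
Definition votes (R : realType) (d : nat) (S : {fset 'rV[R]_d})
    (a b : 'rV[R]_d) : nat :=
  npts S [set y | edist a y < edist b y].

Definition winning_point (R : realType) (d : nat) (S : {fset 'rV[R]_d})
    (a : 'rV[R]_d) : Prop :=
  forall b : 'rV[R]_d, (votes S b a <= votes S a b)%N.

Definition alice_wins (R : realType) (d : nat) (S : {fset 'rV[R]_d}) : Prop :=
  exists a : 'rV[R]_d, winning_point S a.

(* A hyperplane is given by an equation <y, c> = lambda with c != 0.  Distinct
   values may describe the same set of points; rescaling the equation can only
   exchange the two open sides. *)
Record hyperplane (R : realType) (d : nat) := Hyperplane {
  normal : 'rV[R]_d;
  offset : R;
  normal_neq0 : normal != 0
}.

Definition hyp (R : realType) (d : nat) (H : hyperplane R d) :
    set 'rV[R]_d :=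
  [set y | dot y (normal H) = offset H].

Definition hyp_pos (R : realType) (d : nat) (H : hyperplane R d) :
    set 'rV[R]_d :=
  [set y | dot y (normal H) > offset H].

Definition hyp_neg (R : realType) (d : nat) (H : hyperplane R d) :
    set 'rV[R]_d :=
  [set y | dot y (normal H) < offset H].

Definition good (R : realType) (d : nat) (S : {fset 'rV[R]_d})
    (H : hyperplane R d) : Prop :=
  npts S (hyp_pos H) = npts S (hyp_neg H).

Definition perfect (R : realType) (d : nat) (S : {fset 'rV[R]_d})
    (H : hyperplane R d) : Prop :=
  good S H /\ npts S (hyp H) = 1%N.

(* The lines through x are the sets [line x v] with v != 0; x divides such a
   line into the open half-lines [half_line x v] and [half_line x (- v)]. *)
Definition line (R : realType) (d : nat) (x v : 'rV[R]_d) : set 'rV[R]_d :=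
  [set y | exists t : R, y = x + t *: v].

Definition half_line (R : realType) (d : nat) (x v : 'rV[R]_d) :
    set 'rV[R]_d :=
  [set y | exists2 t : R, 0 < t & y = x + t *: v].

Definition balanced (R : realType) (d : nat) (S : {fset 'rV[R]_d})
    (x v : 'rV[R]_d) : Prop :=
  `|(npts S (half_line x v))%:Z - (npts S (half_line x (- v)))%:Z| <= 1.

Definition even_balanced (R : realType) (d : nat) (S : {fset 'rV[R]_d})
    (x v : 'rV[R]_d) : Prop :=
  balanced S x v /\ ~~ odd (npts S (line x v `\ x)).

Definition all_hyperplanes_good (R : realType) (d : nat)
    (S : {fset 'rV[R]_d}) (x : 'rV[R]_d) : Prop :=
  forall H : hyperplane R d, hyp H x -> good S H.

Definition perfect_hyperplanes_through (R : realType) (d : nat)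
    (S : {fset 'rV[R]_d}) (x : 'rV[R]_d) : Prop :=
  forall H : hyperplane R d, perfect S H -> hyp H x.

Definition all_lines_even_balanced (R : realType) (d : nat)
    (S : {fset 'rV[R]_d}) (x : 'rV[R]_d) : Prop :=
  forall v : 'rV[R]_d, v != 0 -> even_balanced S x v.

(* Main.v *)
(* The imbalance of a hyperplane through x with normal c is the signed sum of
   sgn <y - x, c> over y in S.

   (iii) => (i): on balanced lines the points pair off across x, and opposite
   points cancel.
   (i) => (ii): translating a hyperplane across x strictly changes its
   imbalance, so two parallel ones cannot both be good.
   (ii) => (iii): if a hyperplane meets S only in x, perturb its normal until no
   two points of S have the same height; the median hyperplane is then perfect,
   so it passes through x and the original imbalance is 0. Given a line through
   x, take a hyperplane containing it and no further point of S, and tilt it to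
   both sides: both tilts are balanced, hence so is the line.

   Bob's points b = a + e c with e small show that a winning a leaves at most
   half of S on either open side of every hyperplane through a. As |S| is odd,
   generic hyperplanes force a in S and have imbalance 0. Conversely, if (i)
   holds at x, any b gains at most an open half-space bounded by a hyperplane
   through x. *)
Require Import Defs.
From mathcomp Require Import all_boot all_order all_algebra finmap.
From mathcomp Require Import boolp classical_sets reals.
From mathcomp Require Import ring lra zify.

Set Implicit Arguments.
Unset Strict Implicit.
Unset Printing Implicit Defensive.

Import Order.TTheory GRing.Theory Num.Theory.

Local Open Scope ring_scope.

(** * Signs under small perturbations *)

Lemma sgz_pos_sub_neg (R : realType) (a : R) :
  sgz a = (nat_of_bool (0 < a)%R)%:Z - (nat_of_bool (a < 0)%R)%:Z.
Proof. by case: (sgzP a). Qed.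

Lemma le_sgz (R : realType) (a b : R) : a <= b -> sgz a <= sgz b.
Proof. by case: (sgzP a); case: (sgzP b) => // *; exfalso; lra. Qed.

(** For small [e] the term [e * b] matters only when [a] vanishes: [b] breaks the tie. *)
Lemma sgz_perturb (R : realType) (a b : R) :
  exists2 e0 : R, 0 < e0 & forall e, 0 < e -> e <= e0 ->
    sgz (a + e * b) = sgz (if a == 0 then b else a).
Proof.
have [-> | a0] := eqVneq a 0.
  by exists 1 => // e e_gt0 _; rewrite add0r sgzM gtr0_sgz ?mul1r.
(* The [+ 1] permits [b = 0] and makes [e * |b| < |a|] strict. *)
exists (`|a| / (`|b| + 1)) => [|e e_gt0 le_e].
  by rewrite divr_gt0 ?normr_gt0 // ltr_wpDl.
have eb : `|e * b| < `|a|.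
  rewrite normrM (gtr0_norm e_gt0).
  move: le_e; rewrite ler_pdivlMr ?ltr_wpDl //; nra.
move: eb; rewrite ltr_norml => /andP[].
by case: (sgzP a) a0 => //; case: (sgzP (a + e * b)) => // *; exfalso; lra.
Qed.

Lemma sgz_perturb_seq (R : realType) (T : eqType) (f g : T -> R) (s : seq T) :
  exists2 e : R, 0 < e & forall u, u \in s ->
    sgz (f u + e * g u) = sgz (if f u == 0 then g u else f u).
Proof.
(* Asking for all small [e] lets the induction take a minimum of bounds. *)
suff [e e_gt0 eP] : exists2 e0 : R, 0 < e0 & forall u, u \in s ->
    forall e, 0 < e -> e <= e0 ->
    sgz (f u + e * g u) = sgz (if f u == 0 then g u else f u).
  by exists e => // u us; apply: eP.
elim: s => [|v s [e1 e1_gt0 IH]]; first by exists 1.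
have [e2 e2_gt0 vP] := sgz_perturb (f v) (g v).
exists (Num.min e1 e2) => [|u]; first by rewrite lt_min e1_gt0.
rewrite inE => /orP[/eqP-> | us] e e_gt0; rewrite le_min => /andP[le1 le2].
  exact: vP.
exact: IH.
Qed.

(** * Inner product and generic vectors *)

Lemma dotDl (R : realType) (d : nat) (u v w : 'rV[R]_d) :
  dot (u + v) w = dot u w + dot v w.
Proof. by rewrite -big_split; apply: eq_bigr => i _; rewrite mxE mulrDl. Qed.

Lemma dotZl (R : realType) (d : nat) (a : R) (u w : 'rV[R]_d) :
  dot (a *: u) w = a * dot u w.
Proof. by rewrite mulr_sumr; apply: eq_bigr => i _; rewrite mxE mulrA. Qed.

Lemma dotC (R : realType) (d : nat) (u v : 'rV[R]_d) : dot u v = dot v u.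
Proof. by apply: eq_bigr => i _; rewrite mulrC. Qed.

Lemma dotNl (R : realType) (d : nat) (u w : 'rV[R]_d) :
  dot (- u) w = - dot u w.
Proof. by rewrite -scaleN1r dotZl mulN1r. Qed.

Lemma dotBl (R : realType) (d : nat) (u v w : 'rV[R]_d) :
  dot (u - v) w = dot u w - dot v w.
Proof. by rewrite dotDl dotNl. Qed.

Lemma dotDr (R : realType) (d : nat) (u v w : 'rV[R]_d) :
  dot w (u + v) = dot w u + dot w v.
Proof. by rewrite dotC dotDl !(dotC w). Qed.

Lemma dotZr (R : realType) (d : nat) (a : R) (u w : 'rV[R]_d) :
  dot w (a *: u) = a * dot w u.
Proof. by rewrite dotC dotZl (dotC w). Qed.

Lemma dotNr (R : realType) (d : nat) (u w : 'rV[R]_d) :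
  dot w (- u) = - dot w u.
Proof. by rewrite dotC dotNl dotC. Qed.

Lemma dot0l (R : realType) (d : nat) (w : 'rV[R]_d) : dot 0 w = 0.
Proof. by rewrite -(scale0r w) dotZl mul0r. Qed.

Lemma dot0r (R : realType) (d : nat) (w : 'rV[R]_d) : dot w 0 = 0.
Proof. by rewrite dotC dot0l. Qed.

Lemma dot_ge0 (R : realType) (d : nat) (u : 'rV[R]_d) : 0 <= dot u u.
Proof. by apply: sumr_ge0 => i _; rewrite -expr2 sqr_ge0. Qed.

Lemma dot_eq0 (R : realType) (d : nat) (u : 'rV[R]_d) :
  (dot u u == 0) = (u == 0).
Proof.
apply/eqP/eqP => [u0 | ->]; last by rewrite /dot big1 // => i _; rewrite mxE mul0r.
apply/rowP => i; rewrite mxE; apply/eqP; rewrite -[_ == 0]orbb -mulf_eq0.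
apply/eqP; apply: (psumr_eq0P _ u0) => // j _.
by rewrite -expr2 sqr_ge0.
Qed.

Lemma dot_gt0 (R : realType) (d : nat) (u : 'rV[R]_d) :
  u != 0 -> 0 < dot u u.
Proof. by rewrite lt_def dot_ge0 dot_eq0 andbT. Qed.

(** Adding a small multiple of [v] to [w] keeps nonzero products nonzero and makes the product with
    [v] itself nonzero, since [dot v v] is positive. *)
Lemma exists_generic (R : realType) (d : nat) (F : seq 'rV[R]_d) :
  exists w : 'rV[R]_d, forall u, u \in F -> u != 0 -> dot u w != 0.
Proof.
elim: F => [|v F [w wP]]; first by exists 0.
have [e _ eP] :=
  sgz_perturb_seq (fun u => dot u w) (fun u => dot u v) (v :: F).
exists (w + e *: v) => u uF u0.
rewrite -sgz_eq0 dotDr dotZr eP // sgz_eq0.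
case: ifPn => // /eqP uw0; move: uF u0; rewrite inE => /predU1P[-> | uF] u0.
  by rewrite dot_eq0.
by move: (wP u uF u0); rewrite uw0 eqxx.
Qed.

(** * Counts and votes as sums of signs *)

Lemma npts_sum (R : realType) (d : nat) (S : {fset 'rV[R]_d})
    (A : set 'rV[R]_d) :
  (npts S A)%:Z = \sum_(y <- S) (nat_of_bool `[< A y >])%:Z.
Proof.
rewrite /npts card_fset_sum1 big_fset /= (big_morph Posz PoszD (erefl _)).
rewrite big_mkcond; apply: eq_bigr => y _.
by rewrite -(in_setE A y) asboolb; case: ifP.
Qed.

Lemma npts_sub (R : realType) (d : nat) (S : {fset 'rV[R]_d})
    (A B : set 'rV[R]_d) :
  (npts S A)%:Z - (npts S B)%:Z =
  \sum_(y <- S) ((nat_of_bool `[< A y >])%:Z - (nat_of_bool `[< B y >])%:Z).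
Proof. by rewrite !npts_sum sumrB. Qed.

Lemma good_sum (R : realType) (d : nat) (S : {fset 'rV[R]_d})
    (H : hyperplane R d) :
  good S H <-> \sum_(y <- S) sgz (dot y (normal H) - offset H) = 0.
Proof.
have -> : \sum_(y <- S) sgz (dot y (normal H) - offset H) =
    (npts S (hyp_pos H))%:Z - (npts S (hyp_neg H))%:Z.
  rewrite npts_sub; apply: eq_bigr => y _.
  rewrite sgz_pos_sub_neg subr_gt0 subr_lt0.
  by congr (_%:Z - _%:Z); congr nat_of_bool; symmetry; apply: asboolb.
rewrite /good; split => [-> | /eqP]; first by rewrite subrr.
by rewrite subr_eq0 => /eqP[].
Qed.

Lemma good_through_sum (R : realType) (d : nat) (S : {fset 'rV[R]_d})
    (x : 'rV[R]_d) (H : hyperplane R d) (Hx : hyp H x) :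
  good S H <-> \sum_(y <- S) sgz (dot (y - x) (normal H)) = 0.
Proof.
by rewrite good_sum -Hx; under eq_bigr => y _ do rewrite -dotBl.
Qed.

Lemma edist_lt (R : realType) (d : nat) (u v w z : 'rV[R]_d) :
  (edist u v < edist w z) = (dot (u - v) (u - v) < dot (w - z) (w - z)).
Proof. by rewrite !ltNge ler_sqrt ?dot_ge0. Qed.

(** The difference of the squared distances from [y] to [a] and to [b] is affine in [y]; it vanishes
    on the perpendicular bisector. *)
Lemma votes_sub (R : realType) (d : nat) (S : {fset 'rV[R]_d})
    (a b : 'rV[R]_d) :
  (votes S b a)%:Z - (votes S a b)%:Z =
  \sum_(y <- S) sgz (2 * dot (y - a) (b - a) - dot (b - a) (b - a)).
Proof.
rewrite npts_sub; apply: eq_bigr => y _.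
have -> : 2 * dot (y - a) (b - a) - dot (b - a) (b - a) =
    dot (a - y) (a - y) - dot (b - y) (b - y).
  rewrite !(dotBl, dotDr, dotNr) (dotC b y) (dotC a y) (dotC b a); ring.
rewrite sgz_pos_sub_neg subr_gt0 subr_lt0 -!edist_lt.
by congr (_%:Z - _%:Z); congr nat_of_bool; apply: asboolb.
Qed.

(** * Balance on lines *)

(** The sign of [t] at [y = x + t *: v], and 0 off the line. *)
Definition line_sign (R : realType) (d : nat) (x v y : 'rV[R]_d) : int :=
  (nat_of_bool `[< half_line x v y >])%:Z -
  (nat_of_bool `[< half_line x (- v) y >])%:Z.

Lemma half_lineE (R : realType) (d : nat) (x v : 'rV[R]_d) (t : R) :
  v != 0 -> `[< half_line x v (x + t *: v) >] = (0 < t).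
Proof.
move=> v0; apply/asboolP/idP => [[s s_gt0 /addrI /eqP]|t_gt0]; last by exists t.
by rewrite -subr_eq0 -scalerBl scaler_eq0 (negPf v0) orbF subr_eq0 => /eqP->.
Qed.

Lemma half_lineNE (R : realType) (d : nat) (x v : 'rV[R]_d) (t : R) :
  v != 0 -> `[< half_line x (- v) (x + t *: v) >] = (t < 0).
Proof.
move=> v0; rewrite -[t *: v]opprK -scaleNr -scalerN half_lineE ?oppr_eq0 //.
by rewrite oppr_gt0.
Qed.

Lemma half_line_sub (R : realType) (d : nat) (x v : 'rV[R]_d) :
  (half_line x v `|` half_line x (- v) `<=` line x v)%classic.
Proof.
move=> y [] [t _ ->]; first by exists t.
by exists (- t); rewrite scalerN scaleNr.
Qed.

Lemma line_signE (R : realType) (d : nat) (x v : 'rV[R]_d) (t : R) :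
  v != 0 -> line_sign x v (x + t *: v) = sgz t.
Proof.
by move=> v0; rewrite /line_sign half_lineE // half_lineNE // -sgz_pos_sub_neg.
Qed.

Lemma line_sign_out (R : realType) (d : nat) (x v y : 'rV[R]_d) :
  ~ line x v y -> line_sign x v y = 0.
Proof.
move=> nl; rewrite /line_sign !asboolF // => h; apply: nl; apply: half_line_sub.
  by right.
by left.
Qed.

(** The half-lines partition the line without [x], so evenness makes the difference of their counts
    even; being at most 1 in absolute value, it is 0. *)
Lemma even_balanced_sum (R : realType) (d : nat) (S : {fset 'rV[R]_d})
    (x v : 'rV[R]_d) (v0 : v != 0) :
  even_balanced S x v <-> \sum_(y <- S) line_sign x v y = 0.
Proof.
rewrite /line_sign -npts_sub /even_balanced /balanced.
have nl : (npts S (line x v `\ x)%classic)%:Z =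
    (npts S (half_line x v))%:Z + (npts S (half_line x (- v)))%:Z.
  rewrite !npts_sum -big_split; apply: eq_bigr => y _ /=.
  have [[t ->] | nl] := pselect (line x v y); last first.
    by rewrite !asboolF // => [h|h|[]//]; apply: nl; apply: half_line_sub;
      [right|left].
  rewrite half_lineE // half_lineNE //.
  have -> : `[< (line x v `\ x)%classic (x + t *: v) >] = (t != 0).
    apply/asboolP/idP => [[_ /eqP]|t0].
      by rewrite -subr_eq0 addrC addKr scaler_eq0 (negPf v0) orbF.
    split; first by exists t.
    by move/eqP; rewrite -subr_eq0 addrC addKr scaler_eq0 (negPf v0) orbF (negPf t0).
  by case: ltgtP.
by move: nl; lia.
Qed.

Lemma all_hyperplanes_good_sum (R : realType) (d : nat)
    (S : {fset 'rV[R]_d}) (x : 'rV[R]_d) :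
  all_hyperplanes_good S x <->
  forall c, c != 0 -> \sum_(y <- S) sgz (dot (y - x) c) = 0.
Proof.
split=> [good_x c c0 | sum0 H Hx]; last first.
  by apply/(good_through_sum S Hx)/sum0/normal_neq0.
have Hx : hyp (Hyperplane (dot x c) c0) x by [].
exact/(good_through_sum S Hx)/good_x.
Qed.

(** Induction on the size of [T], removing either [x] or two points opposite about [x]; each removal
    preserves all the sums. *)
Lemma line_sums_hyperplane_sum (R : realType) (d : nat) (T : seq 'rV[R]_d)
    (x c : 'rV[R]_d) :
  (forall v, v != 0 -> \sum_(y <- T) line_sign x v y = 0) ->
  \sum_(y <- T) sgz (dot (y - x) c) = 0.
Proof.
have [n] := ubnP (size T); elim: n T => // n IH [|y T] /=; first by rewrite big_nil.
rewrite ltnS => size_T sum0.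
have [y_eq_x | y_neq_x] := eqVneq y x.
  rewrite big_cons y_eq_x subrr dot0l sgz0 add0r.
  apply: IH => // v v0; have := sum0 v v0; rewrite big_cons y_eq_x.
  by rewrite -{2}(addr0 x) -(scale0r v) line_signE // sgz0 add0r.
have v0 : y - x != 0 by rewrite subr_eq0.
have yE : y = x + 1 *: (y - x) by rewrite scale1r addrC subrK.
(* Some point of [T] lies opposite to [y]; the two cancel in every sum. *)
have /hasP[z zT z_lt0] : has (fun z => line_sign x (y - x) z < 0) T.
  apply: contraT => /hasPn z_ge0; have := sum0 _ v0.
  rewrite big_cons {2}yE line_signE // sgz1 => sum1.
  have : 0 <= \sum_(z <- T) line_sign x (y - x) z.
    by rewrite big_seq; apply: sumr_ge0 => z /z_ge0; rewrite -leNgt.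
  by move=> /(ltr_wpDr)/(_ ltr01); rewrite sum1.
have [[t zE]|/line_sign_out z0] := pselect (line x (y - x) z); last first.
  by rewrite z0 in z_lt0.
have t_lt0 : t < 0 by move: z_lt0; rewrite zE line_signE // sgz_lt0.
have permT : perm_eq (y :: T) (y :: z :: rem z T).
  by rewrite perm_cons perm_to_rem.
rewrite (perm_big _ permT) /= !big_cons addrA.
have -> : sgz (dot (y - x) c) + sgz (dot (z - x) c) = 0.
  by rewrite zE addrAC subrr add0r dotZl sgzM (ltr0_sgz t_lt0) mulN1r subrr.
rewrite add0r; apply: IH => [|v v_neq0].
  by rewrite size_rem // (leq_ltn_trans (leq_pred _)).
have := sum0 v v_neq0; rewrite (perm_big _ permT) /= !big_cons addrA.
suff -> : line_sign x v y + line_sign x v z = 0 by rewrite add0r.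
have [[s yvE]|nl] := pselect (line x v y).
  have yx : y - x = s *: v by rewrite yvE addrAC subrr add0r.
  rewrite zE yx scalerA yvE !line_signE // sgzM.
  by rewrite (ltr0_sgz t_lt0) mulN1r subrr.
(* Since [z - x = t *: (y - x)] with [t] nonzero, a line through [x] and [z] also contains [y]. *)
rewrite !line_sign_out // => -[s zvE]; apply: nl; exists (t^-1 * s).
rewrite -scalerA; move: zvE; rewrite zE => /addrI <-.
by rewrite scalerA mulVf ?lt_eqF // -yE.
Qed.

(** * Medians *)

(** Each term is 1 - [a <= z] - [a < z]; in a strictly sorted sequence these two counts can be read
    off from the index of [z]. *)
Lemma sgz_sum_count (R : realType) (r : seq R) (z : R) :
  \sum_(a <- r) sgz (a - z) =
  (size r)%:Z - (count (<= z) r)%:Z - (count (< z) r)%:Z.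
Proof.
elim: r => [|a r IH]; first by rewrite big_nil.
rewrite big_cons IH /= sgz_pos_sub_neg subr_gt0 subr_lt0.
by case: ltgtP => _ /=; lia.
Qed.

Lemma exists_median (R : realType) (T : eqType) (g : T -> R) (s : seq T) :
  uniq s -> odd (size s) -> {in s &, injective g} ->
  exists2 m, m \in s & \sum_(y <- s) sgz (g y - g m) = 0.
Proof.
move=> s_uniq s_odd g_inj.
set r := sort <=%R (map g s).
have size_r : size r = size s by rewrite size_sort size_map.
have r_sorted : sorted <%R r by rewrite sort_lt_sorted map_inj_in_uniq.
have lt_half : ((size s)./2 < size r)%N by rewrite size_r; lia.
have := mem_nth 0 lt_half; rewrite mem_sort => /mapP[m ms mE].
exists m => //.
rewrite -(big_map g predT (fun a => sgz (a - g m))).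
rewrite -(perm_big _ (permEl (perm_sort <=%R _))) -/r -mE sgz_sum_count.
(* With size 2k + 1 and index k the counts are k + 1 and k. *)
rewrite count_le_nth // count_lt_nth // size_r; lia.
Qed.

(** * Equivalence of the three conditions *)

(* Restricts (i) to the hyperplanes through [x] that meet [S] in no other
   point. *)
Definition generic_hyperplanes_good (R : realType) (d : nat)
    (S : {fset 'rV[R]_d}) (x : 'rV[R]_d) : Prop :=
  forall c, c != 0 -> (forall y, y \in S -> y != x -> dot (y - x) c != 0) ->
  \sum_(y <- S) sgz (dot (y - x) c) = 0.

Lemma lines_hyperplanes (R : realType) (d : nat) (S : {fset 'rV[R]_d})
    (x : 'rV[R]_d) :
  all_lines_even_balanced S x -> all_hyperplanes_good S x.
Proof.
move=> lines; apply/all_hyperplanes_good_sum => c _.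
by apply: line_sums_hyperplane_sum => v v0; apply/even_balanced_sum/lines.
Qed.

Lemma hyperplanes_perfect (R : realType) (d : nat) (S : {fset 'rV[R]_d})
    (x : 'rV[R]_d) (xS : x \in S) :
  all_hyperplanes_good S x -> perfect_hyperplanes_through S x.
Proof.
move=> /all_hyperplanes_good_sum sum_x H [/good_sum sum_H _].
have := sum_x _ (normal_neq0 H).
under eq_bigr => y _ do rewrite dotBl.
rewrite -[hyp H x]/(dot x (normal H) = offset H).
move: (normal H) (offset H) sum_H => c l sum_l sum_c.
(* As the threshold rises from [a] to [b] no term increases, and the term of [x], which is 0 at one
   end, drops strictly. The disjunction covers a translate on either side of [x]. *)
have mono a b : a < b -> a = dot x c \/ b = dot x c ->
    \sum_(y <- S) sgz (dot y c - a) = 0 ->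
    \sum_(y <- S) sgz (dot y c - b) = 0 -> False.
  move=> lt_ab ab sum_a sum_b.
  have : \sum_(y <- S) sgz (dot y c - b) < \sum_(y <- S) sgz (dot y c - a).
    rewrite (big_fsetD1 x) //= [ltRHS](big_fsetD1 x) //=.
    apply: ltr_leD; last by apply: ler_sum => y _; apply: le_sgz; lra.
    by case: ab => <-; rewrite subrr sgz0 ?sgz_lt0 ?sgz_gt0; lra.
  by rewrite sum_a sum_b.
by case: (ltgtP (dot x c) l) => // lt; case: (mono _ _ lt); auto.
Qed.

Lemma perfect_generic (R : realType) (d : nat) (S : {fset 'rV[R]_d})
    (hS : odd #|` S|) (x : 'rV[R]_d) (xS : x \in S) :
  perfect_hyperplanes_through S x -> generic_hyperplanes_good S x.
Proof.
move=> perfect_x c c0 c_generic.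
pose D := [seq y - z | y <- S, z <- S].
have [w wP] := exists_generic D.
(* Including [c] in the list ensures that the perturbed normal [c'] is nonzero. *)
have [e e_gt0 eP] :=
  sgz_perturb_seq (fun u => dot u c) (fun u => dot u w) (c :: D).
set c' := c + e *: w.
have dot_c' u : dot u c' = dot u c + e * dot u w by rewrite dotDr dotZr.
have c'0 : c' != 0.
  apply: contraNneq c0 => c'0; rewrite -dot_eq0.
  have := eP c (mem_head _ _); rewrite -dot_c' c'0 dot0r sgz0.
  by case: eqP => // cc /esym/eqP; rewrite sgz_eq0 => /eqP.
have inD y z : y \in S -> z \in S -> y - z \in D.
  by move=> yS zS; apply: (allpairs_f (fun y z => y - z)).
have incD y z : y \in S -> z \in S -> y - z \in c :: D.
  by move=> yS zS; rewrite inE inD ?orbT.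
have inj : {in S &, injective (fun y => dot y c')}.
  move=> y z yS zS /eqP; rewrite -subr_eq0 -dotBl dot_c' -sgz_eq0 eP ?incD //.
  rewrite sgz_eq0; case: ifPn => [_|/negPf-> //].
  have [/eqP|yz] := eqVneq (y - z) 0; first by rewrite subr_eq0 => /eqP.
  by rewrite (negPf (wP _ _ yz)) ?inD.
have [m mS sum_m] := exists_median (fset_uniq S) hS inj.
(* By injectivity of the heights, the hyperplane through the median point [m] meets [S] only in
   [m]. *)
have xm : dot x c' = dot m c'.
  apply: (perfect_x (Hyperplane (dot m c') c'0)); split; first exact/good_sum.
  apply/eqP; rewrite -eqz_nat npts_sum (big_fsetD1 m) //= asboolT //.
  rewrite big_seq big1 // => y; rewrite in_fsetD1 => /andP[ym yS].
  by rewrite asboolF // => /inj-/(_ yS mS) yE; rewrite yE eqxx in ym.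
(* Passing from [c'] back to [c] changes no sign: by genericity only [y = x] has product 0 with [c],
   and its sign is 0 for both. *)
rewrite -[RHS]sum_m !big_seq; apply: eq_bigr => y yS.
rewrite -xm -dotBl dot_c' eP ?incD //; case: ifPn => // /eqP y0.
have [->|/(c_generic y yS)] := eqVneq y x; last by rewrite y0 eqxx.
by rewrite subrr !dot0l.
Qed.

Lemma generic_lines (R : realType) (d : nat) (S : {fset 'rV[R]_d})
    (x : 'rV[R]_d) :
  generic_hyperplanes_good S x -> all_lines_even_balanced S x.
Proof.
move=> good_x v v0; apply/(even_balanced_sum S x v0).
have vv0 : dot v v != 0 by rewrite dot_eq0.
(* Projection onto the orthogonal complement of [v]. With [w] generic for the projected points,
   [c := pr w] is orthogonal to [v] and to no [y - x] off the line. *)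
pose pr (u : 'rV[R]_d) := u - (dot u v / dot v v) *: v.
have [w wP] := exists_generic [seq pr (y - x) | y <- S].
pose c := pr w.
have vc : dot v c = 0 by rewrite dotDr dotNr dotZr (dotC v w) divfK ?subrr.
have pr_c u : dot u c = dot (pr u) w.
  by rewrite dotDr dotNr dotBl dotZr dotZl (dotC w v); field.
have on_line y : y \in S -> dot (y - x) c = 0 -> line x v y.
  move=> yS; rewrite pr_c => y0; exists (dot (y - x) v / dot v v).
  apply/eqP; rewrite addrC -subr_eq -subr_eq0; apply: contraPT y0 => py0.
  by apply/eqP/(wP (pr (y - x))) => //; apply: map_f.
(* Tilting the hyperplane slightly towards [v] and towards [- v] keeps it
   generic; the two sums differ by twice the signed count on the line. *)
pose side v' y := sgz (if dot (y - x) c == 0 then dot (y - x) v'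
                       else dot (y - x) c).
have tilt v' : v' = v \/ v' = - v -> \sum_(y <- S) side v' y = 0.
  move=> v'E; have [e e_gt0 eP] := sgz_perturb_seq
    (fun y => dot (y - x) c) (fun y => dot (y - x) v') S.
  have v'v : dot v v' != 0.
    by case: v'E => ->; rewrite ?dotNr ?oppr_eq0.
  have eP' y : y \in S -> sgz (dot (y - x) (c + e *: v')) = side v' y.
    by move=> yS; rewrite dotDr dotZr eP.
  rewrite big_seq -(eq_bigr _ eP') -big_seq; apply: good_x.
    (* [c] itself may vanish when [S] lies on the line; the tilted normal does not, since its
       product with [v] is [e * dot v v']. *)
    apply: contraNneq v'v => c0; have : dot v (c + e *: v') = 0.
      by rewrite c0 dot0r.
    by rewrite dotDr dotZr vc add0r => /eqP; rewrite mulf_eq0 gt_eqF.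
  move=> y yS yx; rewrite -sgz_eq0 eP' // sgz_eq0; case: ifPn => // /eqP y0.
  have [t yE] := on_line y yS y0; move: yx.
  rewrite yE addrAC subrr add0r dotZl mulf_eq0 (negPf v'v) orbF.
  by apply: contraNneq => ->; rewrite scale0r addr0.
have : \sum_(y <- S) line_sign x v y + \sum_(y <- S) line_sign x v y =
    \sum_(y <- S) side v y - \sum_(y <- S) side (- v) y.
  rewrite -sumrB -big_split !big_seq.
  apply: eq_bigr => y yS /=; rewrite /side; have [y0|y0] := eqVneq (dot (y - x) c) 0.
    have [t ->] := on_line y yS y0.
    rewrite line_signE // addrAC subrr add0r dotNr sgzN opprK dotZl sgzM.
    by rewrite (gtr0_sgz (dot_gt0 v0)) mulr1.
  rewrite line_sign_out ?subrr // => -[t yE]; case/eqP: y0.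
  by rewrite yE addrAC subrr add0r dotZl vc mulr0.
rewrite (tilt v) ?(tilt (- v)); [|by right|by left].
by move/eqP; rewrite subrr -mulr2n mulrn_eq0 => /eqP.
Qed.

(** * Winning points *)

Lemma hyperplanes_winning (R : realType) (d : nat) (S : {fset 'rV[R]_d})
    (x : 'rV[R]_d) :
  all_hyperplanes_good S x -> winning_point S x.
Proof.
move=> /all_hyperplanes_good_sum sum0 b.
have [-> // | bx] := eqVneq b x.
(* Bob's lead is compared termwise with the zero sum for the normal [b - x]:
   [sgz (2 * p - q) <= sgz p] because [q >= 0]. *)
rewrite -lez_nat -subr_le0 votes_sub -[leRHS](sum0 (b - x)) ?subr_eq0 //.
apply: ler_sum => y _; have := dot_ge0 (b - x).
move: (dot _ _) (dot _ _) => p q q_ge0.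
by case: (sgzP p); case: (sgzP (2 * p - q)) => // *; exfalso; lra.
Qed.

(* Bob answers with [a + e c] for an infinitesimal [e], which concedes to Alice
   the hyperplane through [a] and gives him its positive side. *)
Lemma winning_sum (R : realType) (d : nat) (S : {fset 'rV[R]_d})
    (a c : 'rV[R]_d) :
  winning_point S a -> c != 0 ->
  \sum_(y <- S) sgz (if dot (y - a) c == 0 then -1 else dot (y - a) c) <= 0.
Proof.
move=> win c0; have cc_gt0 := dot_gt0 c0.
have [e e_gt0 eP] := sgz_perturb_seq
  (fun y => 2 * dot (y - a) c) (fun=> - dot c c) S.
have := win (a + e *: c); rewrite -lez_nat -subr_le0 votes_sub.
apply: le_trans; rewrite le_eqVlt; apply/orP; left; apply/eqP.
rewrite !big_seq; apply: eq_bigr => y yS.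
rewrite (addrAC a) subrr add0r !(dotZl, dotZr).
(* With one factor [e] taken out, a perturbation by [- dot c c] remains; its sign gives the tie
   value -1. *)
have -> : 2 * (e * dot (y - a) c) - e * (e * dot c c) =
    e * (2 * dot (y - a) c + e * - dot c c) by ring.
rewrite sgzM (gtr0_sgz e_gt0) mul1r eP // mulf_eq0 pnatr_eq0 /=.
case: ifP => _; first by rewrite !sgzN sgz1 (gtr0_sgz cc_gt0).
by rewrite sgzM (gtr0_sgz (ltr0Sn R 1)) mul1r.
Qed.

(** Every term is 1 or -1, hence odd. *)
Lemma sgz_sum_parity (R : realType) (T : eqType) (f : T -> R) (s : seq T) :
  (forall y, y \in s -> f y != 0) ->
  exists k : int, \sum_(y <- s) sgz (f y) = (size s)%:Z + 2 * k.
Proof.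
elim: s => [|y s IH] f0; first by exists 0; rewrite big_nil.
have [z zs|k kE] := IH; first by apply: f0; rewrite inE zs orbT.
rewrite big_cons kE /=; have := f0 y (mem_head _ _).
case: (sgzP (f y)) => // _ _; [exists k | exists (k - 1)]; lia.
Qed.

(** [winning_sum] for [c] and [- c] bounds the imbalance on both sides, and parity settles the
    rest. *)
Lemma winning_generic (R : realType) (d : nat) (S : {fset 'rV[R]_d})
    (hS : odd #|` S|) (a : 'rV[R]_d) :
  winning_point S a -> a \in S /\ generic_hyperplanes_good S a.
Proof.
move=> win.
have sum_nz (T : {fset 'rV[R]_d}) c :
    (forall y, y \in T -> dot (y - a) c != 0) ->
    \sum_(y <- T) sgz (if dot (y - a) c == 0 then -1 else dot (y - a) c) =
    \sum_(y <- T) sgz (dot (y - a) c).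
  by move=> Tc; apply: eq_big_seq => y yT /=; rewrite (negPf (Tc y yT)).
have sumN (T : {fset 'rV[R]_d}) c :
    \sum_(y <- T) sgz (dot (y - a) (- c)) = - \sum_(y <- T) sgz (dot (y - a) c).
  by rewrite -sumrN; apply: eq_bigr => y _; rewrite dotNr sgzN.
have aS : a \in S.
  apply: contraT => aNS.
  have [w wP] := exists_generic [seq y - a | y <- S].
  have w_generic y : y \in S -> dot (y - a) w != 0.
    move=> yS; apply: wP; first by apply/mapP; exists y.
    by rewrite subr_eq0; apply: contraNneq aNS => <-.
  have wN_generic y : y \in S -> dot (y - a) (- w) != 0.
    by move=> yS; rewrite dotNr oppr_eq0 w_generic.
  have /hasP[y yS _] : has predT S by rewrite has_predT odd_gt0.
  have w0 : w != 0.
    by apply: contraNneq (w_generic y yS) => ->; rewrite dot0r.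
  have wN0 : - w != 0 by rewrite oppr_eq0.
  (* If [a] is not in [S], the imbalance is odd, yet both bounds force it to be 0. *)
  have [k kE] := sgz_sum_parity w_generic.
  have := winning_sum win w0; have := winning_sum win wN0.
  have odd_neq0 (n : nat) (j : int) :
      odd n -> - (n%:Z + 2 * j) <= 0 -> n%:Z + 2 * j <= 0 -> False by lia.
  rewrite !sum_nz // sumN kE => sN s0.
  by case: (odd_neq0 _ _ hS sN s0).
split=> // c c0 c_generic.
have Da y : y \in (S `\ a)%fset -> dot (y - a) c != 0.
  by rewrite in_fsetD1 => /andP[ya yS]; apply: c_generic.
have DNa y : y \in (S `\ a)%fset -> dot (y - a) (- c) != 0.
  by move=> yD; rewrite dotNr oppr_eq0 Da.
have [k kE] := sgz_sum_parity Da.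
have cN0 : - c != 0 by rewrite oppr_eq0.
have := winning_sum win c0; have := winning_sum win cN0.
rewrite !(big_fsetD1 a aS) /= !subrr !dot0l eqxx sgzN sgz1 sgz0 add0r.
rewrite !sum_nz // sumN kE.
(* The -1 is the tie at [a] itself; the other points give an even sum between -1 and 1. *)
have even_eq0 (n : nat) (j : int) : ~~ odd n -> -1 - (n%:Z + 2 * j) <= 0 ->
    -1 + (n%:Z + 2 * j) <= 0 -> n%:Z + 2 * j = 0 by lia.
by apply: even_eq0; move: hS; rewrite (cardfsD1 a) aS.
Qed.

Theorem theorem2 (R : realType) (d : nat) (S : {fset 'rV[R]_d})
    (hd : (2 <= d)%N) (hS : odd #|` S|) :
  [/\ forall x : 'rV[R]_d, x \in S ->
        (all_hyperplanes_good S x <-> perfect_hyperplanes_through S x) /\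
        (perfect_hyperplanes_through S x <-> all_lines_even_balanced S x),
      alice_wins S <->
        (exists2 x : 'rV[R]_d, x \in S &
          [/\ all_hyperplanes_good S x,
              perfect_hyperplanes_through S x &
              all_lines_even_balanced S x])
    & forall x : 'rV[R]_d, x \in S ->
        [/\ all_hyperplanes_good S x,
            perfect_hyperplanes_through S x &
            all_lines_even_balanced S x] ->
        winning_point S x].
Proof.
split; first 1 last.
- split=> [[a /(winning_generic hS)[aS good_a]] | [x xS [good_x _ _]]].
    have lines_a := generic_lines good_a.
    have good_hyp := lines_hyperplanes lines_a.
    by exists a => //; split => //; apply: hyperplanes_perfect.
  by exists x; apply: hyperplanes_winning.
- by move=> x xS [good_x _ _]; apply: hyperplanes_winning.
move=> x xS.
have i_ii := hyperplanes_perfect xS.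
have ii_iii : perfect_hyperplanes_through S x -> all_lines_even_balanced S x.
  by move=> /(perfect_generic hS xS); apply: generic_lines.
by split; split; auto using lines_hyperplanes.
Qed.
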